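(* Let $S=\mathbb{C}^2$ and let $L=\mathcal{O}_S\langle v_1\rangle$ be a $\mathsf{T}$-equivariant line bundle over $S$. Then $$\mathcal{C}_S(\mathcal{O}_S,L;q)=\left(\frac{1}{1-q}\right)^{\int_S c(L)c_1(S)}.$$
   Context: The torus $(\mathbb{C}^* )^2$ acts naturally on $S=\mathbb{C}^2$ with tangent weights $t_1,t_2$ at the origin; $v_1$ is the weight of the trivial line bundle $L=\mathcal{O}_S\langle v_1\rangle$, treated as an additional independent parameter. Write $\lambda_1,\lambda_2,w_1$ for the equivariant first Chern classes of $t_1,t_2,v_1$. Equivariant Chern classes: $c(L)=1+w_1$, $c_1(S)=\lambda_1+\lambda_2$. Equivariant push-forward: $\int_S\gamma=\gamma/(\lambda_1\lambda_2)$. $\mathcal{C}_S(\mathcal{O}_S,L;q)$ is the equivariant virtual Chern series of $\operatorname{Hilb}^n(S)=\operatorname{Quot}_S(\mathcal{O}_S,n)$, defined by virtual localization: $$\mathcal{C}_S(\mathcal{O}_S,L;q)=\sum_{n\ge0}q^n\int_{[\operatorname{Hilb}^n(S)]^{\mathrm{vir}}}c(L^{[n]})=\sum_{\mu}q^{|\mu|}\frac{c(L^{[n]}|_{Z_\mu})}{e(T^{\mathrm{vir}}_{Z_\mu})},$$ the sum being over all partitions $\mu$ (with $n=|\mu|$). A partition $\mu$ is identified with its set of boxes $\{(i,j)\in\mathbb{Z}_{\ge0}^2: j<\mu_{i+1}\}$, and $Q_\mu=\sum_{(i,j)\in\mu}t_1^{-j}t_2^{-i}$. Then $T^{\mathrm{vir}}_{Z_\mu}=Q_\mu-(1-t_1)(1-t_2)\overline{Q_\mu}Q_\mu$,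 where $\overline{(\cdot)}$ inverts all weights, and $L^{[n]}|_{Z_\mu}=v_1Q_\mu$. For a virtual character $\sum_\chi n_\chi\chi$, $e=\prod_\chi c_1(\chi)^{n_\chi}$ and $c=\prod_\chi(1+c_1(\chi))^{n_\chi}$. The power $(1-q)^{-x}$ means $\exp(-x\log(1-q))$, and the identity is one of power series in $q$ over $\mathbb{C}(\lambda_1,\lambda_2,w_1)$. *)

(* Defs.v *)
From mathcomp Require Import all_boot all_order all_algebra.
From mathcomp Require Import fraction freeg mpoly.
From mathcomp Require Import reals complex.

Set Implicit Arguments.
Unset Strict Implicit.
Unset Printing Implicit Defensive.

Import GRing.Theory.
Local Open Scope ring_scope.

(* The weight (a, b, c) stands for the monomial t1^a t2^b v1^c, so that the
   group law on weights is written additively. A virtual character is a finite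
   Z-linear combination of weights. *)
Notation weight := (int * int * int)%type.
Notation vchar := {freeg weight / int}.

Definition mon (a b c : int) : vchar := << (a, b, c) : weight >>.
Definition ch1 : vchar := mon 0 0 0.
Definition t1 : vchar := mon 1 0 0.
Definition t2 : vchar := mon 0 1 0.
Definition v1 : vchar := mon 0 0 1.

Definition vmul (V W : vchar) : vchar :=
  \sum_(x <- dom V) \sum_(y <- dom W) << coeff x V * coeff y W *g x + y >>.

Definition vdual (V : vchar) : vchar :=
  \sum_(x <- dom V) << coeff x V *g - x >>.

Lemma vmul_mon a b c a' b' c' :
  vmul (mon a b c) (mon a' b' c') = mon (a + a') (b + b') (c + c').
Proof.
by rewrite /vmul /mon !domU1 !big_seq1 !coeffU !eqxx.
Qed.

Lemma vdual_mon a b c : vdual (mon a b c) = mon (- a) (- b) (- c).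
Proof. by rewrite /vdual /mon !domU1 !big_seq1 !coeffU !eqxx. Qed.

(* A partition mu of n, padded with zeros to exactly n parts. *)
Definition is_partition (n : nat) (mu : n.-tuple 'I_n.+1) : bool :=
  sorted geq [seq val k | k <- mu] && (sumn [seq val k | k <- mu] == n).

(* The boxes (i, j) with j < mu_(i+1); parts are indexed from 0 in the list. *)
Definition boxes (mu : seq nat) : seq (nat * nat) :=
  [seq (i, j) | i <- iota 0 (size mu), j <- iota 0 (nth 0%N mu i)].

(* The fixed point Z_mu, as the character of its structure sheaf. *)
Definition Qchar (mu : seq nat) : vchar :=
  \sum_(b <- boxes mu) mon (- (b.2)%:Z) (- (b.1)%:Z) 0.

Definition Tvir (mu : seq nat) : vchar :=
  Qchar mu -
  vmul (vmul (ch1 - t1) (ch1 - t2)) (vmul (vdual (Qchar mu)) (Qchar mu)).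

Definition Ltaut (mu : seq nat) : vchar := vmul v1 (Qchar mu).

(* The tangent space of S at the origin. *)
Definition tangentS : vchar := t1 + t2.

Section ChernClasses.
(* l1, l2, w are the first Chern classes of the weights t1, t2, v1. *)
Variables (K : fieldType) (l1 l2 w : K).

Definition c1w (x : weight) : K := l1 *~ x.1.1 + l2 *~ x.1.2 + w *~ x.2.

Definition chern1 (V : vchar) : K := \sum_(x <- dom V) c1w x *~ coeff x V.

(* Multiplicities may be negative: ^ is the integer power of ssrint. *)
Definition euler (V : vchar) : K := \prod_(x <- dom V) c1w x ^ coeff x V.
Definition chern (V : vchar) : K := \prod_(x <- dom V) (1 + c1w x) ^ coeff x V.

Definition integralS (g : K) : K := g / (l1 * l2).

Lemma chern_v1 : chern v1 = 1 + w.
Proof.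
by rewrite /chern /v1 /mon domU1 big_seq1 coeffU eqxx /c1w /= mulr1z !add0r.
Qed.

Lemma dom_tangentS :
  perm_eq (dom tangentS) [:: (1, 0, 0) : weight; (0, 1, 0)].
Proof.
apply: uniq_perm; [exact: uniq_dom | by [] | ].
move=> x; rewrite mem_dom /tangentS /t1 /t2 /mon coeffD !coeffU !mul1r.
rewrite !inE ![x == _]eq_sym.
by case: (_ =P x) => [<-//|_]; case: (_ == x).
Qed.

Lemma chern1_tangentS : chern1 tangentS = l1 + l2.
Proof.
rewrite /chern1 (perm_big _ dom_tangentS) /= big_cons big_seq1.
rewrite /tangentS /t1 /t2 /mon !coeffD !coeffU /c1w /=.
by rewrite !addr0 add0r !mulr1z.
Qed.

Lemma euler_tangentS : euler tangentS = l1 * l2.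
Proof.
rewrite /euler (perm_big _ dom_tangentS) /= big_cons big_seq1.
rewrite /tangentS /t1 /t2 /mon !coeffD !coeffU /c1w /=.
by rewrite !addr0 add0r !mulr1z.
Qed.

(* The integral of c(L^[n]) over the virtual class of Hilb^n(S), defined by
   virtual localization: the coefficient of q^n in the Chern series. *)
Definition chern_series (n : nat) : K :=
  \sum_(mu : n.-tuple 'I_n.+1 | is_partition mu)
    chern (Ltaut [seq val k | k <- mu]) / euler (Tvir [seq val k | k <- mu]).

End ChernClasses.

(* Formal power series in q, given by their coefficients. *)
Section PowerSeries.
Variable K : fieldType.
Implicit Types (f g a : nat -> K) (x : K) (n m : nat).

Definition fps_one n : K := (n == 0%N)%:R.
Definition fps_X n : K := (n == 1%N)%:R.
Definition fps_sub f g n : K := f n - g n.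
Definition fps_scale x f n : K := x * f n.
Definition fps_mul f g n : K := \sum_(i < n.+1) f i * g (n - i)%N.
Definition fps_expn f m : nat -> K := iter m (fps_mul f) fps_one.

(* sum_m a_m f^m, for f without constant term: then f^m only has terms of
   degree at least m, so that the m > n do not contribute to degree n. *)
Definition fps_comp a f n : K := \sum_(m < n.+1) a m * fps_expn f m n.

(* For f without constant term. *)
Definition fps_exp f : nat -> K := fps_comp (fun m => (m`!)%:R^-1) f.

(* log (1 + g) = sum_(m > 0) (-1)^(m-1) g^m / m, with 1 + g = f. *)
Definition fps_log f : nat -> K :=
  fps_comp (fun m => if m is k.+1 then (-1) ^+ k / m%:R else 0)
    (fps_sub f fps_one).

Definition fps_powr f x : nat -> K := fps_exp (fps_scale x (fps_log f)).

End PowerSeries.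

(* The field C(lambda1, lambda2, w1); C is the field of complex numbers over an
   arbitrary model R of the real numbers. *)
Section EquivariantField.
Variable R : realType.

Definition eqfield : fieldType := {fraction {mpoly (complex R)[3]}}.
Definition lambda1 : eqfield := tofrac 'X_(inord 0).
Definition lambda2 : eqfield := tofrac 'X_(inord 1).
Definition w1 : eqfield := tofrac 'X_(inord 2).

End EquivariantField.

(* Main.v *)
Require Import Defs.
From HB Require Import structures.
From mathcomp Require Import all_boot all_order all_algebra.
From mathcomp Require Import fraction freeg mpoly.
From mathcomp Require Import reals complex.
From mathcomp Require Import ring zify.

Set Implicit Arguments.
Unset Strict Implicit.
Unset Printing Implicit Defensive.

Import GRing.Theory Num.Theory.
Local Open Scope ring_scope.

(** The coefficients of [(1 - q)^x] are determined by a recursion of order one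
    ([fps_powr_1subX], from the differential equation of the exponential). The
    theorem follows once the coefficients [C_n] of the Chern series satisfy
    the same recursion, which with [L = l1 + l2] reads
      [(n + 1) l1 l2 C_(n+1) = ((1 + w) L + n l1 l2) C_n]
    ([hilb_sum_rec]). It comes from a sum over the pairs of partitions
    [mu] and [nu] where [nu] is [mu] with one more box, evaluated in two ways.

    The fixed point of [mu] enters through its corners. The character
    [1 - (1 - t1) (1 - t2) Q^*], where [Q^*] is the dual of [Q], telescopes
    along each row of [mu] into a sum of outer corners [x_i] minus a sum of
    inner corners [y_j] ([corner_charE]). On first Chern classes it becomes
      [F u = \prod_i (u - x_i) / \prod_j (u - y_j)].
    The residues of [1 / F] live at the addable boxes ([up_weight]) and those of
    [F] at the removable ones, shifted by [L] ([down_weight]). Their sums are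
    read off from the expansion at infinity, that is, from the first two power
    sums of the corners: by Lagrange interpolation, the residues of [F] add up
    to [l1 l2 |mu|] ([down_sum]), and those of [1 / F] have moments [1], [0] and
    [- l1 l2 |mu|] ([up_moments]).

    The difference of the virtual tangent spaces at [nu] and [mu] is linear in
    the corner character and its dual ([Tvir_incr]), so that the ratio of
    Euler classes is an explicit product over the corners of [mu]. This product
    turns a residue at a removable box of [nu] into a residue at the
    corresponding addable box of [mu]: if the new box has weight [X], the
    contribution of [nu] times its residue is the contribution of [mu] times
    [(1 + w - X) (L + X)] times its residue ([growth_term]). Summing over all
    pairs gives the recursion. Row lengths are padded with zeros to a fixed
    number of rows, and two equal consecutive rows need no special care, as the
    corresponding residues vanish.

    The argument takes place over any field in which no nonzero weight has a
    vanishing first Chern class and no weight has first Chern class [- 1]; both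
    hold for independent parameters over the complex numbers. *)

(** * Power series: the binomial recursion *)

Section PowerSeries.
Variable K : fieldType.
Hypothesis natrS_neq0 : forall n, n.+1%:R != 0 :> K.
Implicit Types (f g : nat -> K) (p : {poly K}).

(** Coefficients of index at least [N] are unconstrained, so that a power
    series can be traded for a polynomial, and the calculus of polynomials
    (powers, derivatives) applies to any single coefficient. *)
Definition agree f p N := forall n, (n < N)%N -> f n = p`_n.

Lemma agree_poly f N : agree f (\poly_(i < N) f i) N.
Proof. by move=> n ltnN; rewrite coef_poly ltnN. Qed.

Lemma agree_mul f g p q N :
  agree f p N -> agree g q N -> agree (fps_mul f g) (p * q) N.
Proof.
move=> fp gq n ltnN; rewrite coefM; apply: eq_bigr => i _.
by rewrite fp ?gq //; apply: leq_ltn_trans ltnN; rewrite ?leq_subr // -ltnS.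
Qed.

Lemma agree_expn f p N m : agree f p N -> agree (fps_expn f m) (p ^+ m) N.
Proof.
move=> fp; elim: m => [|m IHm]; first by move=> n _; rewrite expr0 coef1.
by rewrite exprS; apply: agree_mul.
Qed.

Lemma coef_exp_lt p m n : p`_0 = 0 -> (n < m)%N -> (p ^+ m)`_n = 0.
Proof.
move=> p0 ltnm.
have /dvdpP[q ->]: 'X %| p.
  by rewrite -['X]subr0 -polyC0 dvdp_XsubCl /root horner_coef0 p0.
by rewrite exprMn coefMXn ltnm.
Qed.

(** Only the term [m = n] of the composition survives, since the series being
    substituted is the monomial [- q]. At [n = 0] both sides vanish because
    [0^-1 = 0]. *)
Lemma fps_log_1subX n :
  fps_log (fps_sub (fps_one K) (fps_X K)) n = - n%:R^-1.
Proof.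
rewrite /fps_log /fps_comp; set f := fps_sub _ (fps_one K).
have fX N : agree f (- 'X) N.
  by move=> i _; rewrite coefN coefX /f /fps_sub /fps_one /fps_X; ring.
rewrite big_ord_recr big1 /= => [|m _]; rewrite (agree_expn _ (fX n.+1)) //.
  rewrite -scaleN1r exprZn coefZ coefXn eqxx mulr1 add0r.
  case: n => [|n]; first by rewrite mul0r invr0 oppr0.
  by rewrite mulrAC -exprD addnS -signr_odd oddS oddD addbb expr1 mulN1r.
by rewrite -scaleN1r exprZn coefZ coefXn gtn_eqF ?ltn_ord ?mulr0.
Qed.

(** The truncated exponential satisfies [exp' = exp] up to one lost term, which
    is the reason for the two different bounds of summation. *)
Lemma deriv_exp_trunc p n :
  (\sum_(m < n.+1) m`!%:R^-1 *: p ^+ m)^`() =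
  (\sum_(m < n) m`!%:R^-1 *: p ^+ m) * p^`().
Proof.
rewrite big_ord_recl expr0 derivD derivZ derivC scaler0 add0r.
rewrite raddf_sum mulr_suml; apply: eq_bigr => m _.
rewrite /= derivZ deriv_exp /bump leq0n add1n /= -scaler_nat scalerA.
rewrite factS natrM invfM mulrAC mulVf // mul1r.
by rewrite -scalerAl mulrC.
Qed.

(** This is [(exp g)' = exp g * g'], coefficient by coefficient. The terms of
    the exponential series that the truncation discards start in degree [n +
    1], because [g] has no constant term. *)
Lemma fps_exp_deriv g n : g 0%N = 0 ->
  n.+1%:R * fps_exp g n.+1 =
  \sum_(i < n.+1) fps_exp g i * ((n - i).+1%:R * g (n - i).+1).
Proof.
move=> g0; pose p := \poly_(i < n.+2) g i.
have gp : agree g p n.+2 by apply: agree_poly.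
have p0 : p`_0 = 0 by rewrite -gp.
pose E k := \sum_(m < k) m`!%:R^-1 *: p ^+ m.
have hE k j : (j < k <= n.+2)%N -> fps_exp g j = (E k)`_j.
  case/andP=> ltjk lekn; rewrite /fps_exp /fps_comp coef_sum.
  rewrite (big_ord_widen k (fun m => m`!%:R^-1 * fps_expn g m j)) //.
  rewrite big_mkcond; apply: eq_bigr => m _.
  rewrite (agree_expn _ gp) ?coefZ; last exact: leq_trans lekn.
  by case: ltnP => // ltjm; rewrite coef_exp_lt ?mulr0.
have := congr1 (fun q : {poly K} => q`_n) (deriv_exp_trunc p n.+1).
rewrite -/(E n.+1) -/(E n.+2) coef_deriv -hE ?leqnn //= mulr_natl => ->.
rewrite coefM; apply: eq_bigr => i _.
rewrite -(hE n.+1 i); last by rewrite ltn_ord leqnSn.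
rewrite coef_deriv mulr_natl -gp //.
by rewrite !ltnS leq_subr.
Qed.

(** The recursion satisfied by the coefficients of [(1 - q)^x]; it is what both
    sides of the theorem are compared through. *)
Definition binomial_rec (x : K) f :=
  f 0%N = 1 /\ forall n, n.+1%:R * f n.+1 = (n%:R - x) * f n.

Lemma binomial_rec_uniq x f g : binomial_rec x f -> binomial_rec x g -> f =1 g.
Proof.
move=> [f0 fS] [g0 gS]; elim=> [|n IHn]; first by rewrite f0 g0.
by apply: (mulfI (natrS_neq0 n)); rewrite fS gS IHn.
Qed.

(** Since [q (x log (1 - q))'] has all its positive coefficients equal to [-
    x], the differential equation of the exponential expresses [(n + 1)
    h_(n+1)] as [- x] times a partial sum of [h]; consecutive such equations
    differ by a single term. *)
Lemma fps_powr_1subX x :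
  binomial_rec x (fps_powr (fps_sub (fps_one K) (fps_X K)) x).
Proof.
rewrite /fps_powr; set g := fps_scale x _; set h := fps_exp g.
have gE n : g n = - (x * n%:R^-1) by rewrite /g /fps_scale fps_log_1subX mulrN.
have g0 : g 0%N = 0 by rewrite gE invr0 mulr0 oppr0.
have hS n : n.+1%:R * h n.+1 = - x * \sum_(i < n.+1) h i.
  rewrite fps_exp_deriv // mulr_sumr; apply: eq_bigr => i _.
  by rewrite gE -/h mulrN mulrCA mulfV // mulr1 mulrC.
split=> [|[|n]].
- by rewrite /h /fps_exp /fps_comp big_ord1 /= invr1 mul1r.
- by rewrite hS big_ord1 sub0r.
rewrite hS big_ord_recr mulrDr -hS /=; ring.
Qed.
End PowerSeries.

(** * Lagrange interpolation *)

Lemma big_mkseq_ord (R I : Type) (idx : R) (op : R -> R -> R) (z : nat -> I) n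
    (F : I -> R) :
  \big[op/idx]_(x <- mkseq z n) F x = \big[op/idx]_(i < n) F (z i).
Proof. by rewrite big_map -(big_mkord xpredT (F \o z)) /index_iota subn0. Qed.

Lemma prod_ordD1 (R : comPzSemiRingType) n i (F : nat -> R) : (i < n)%N ->
  \prod_(j < n) F j = F i * \prod_(j < n | val j != i) F j.
Proof. by move=> ltin; rewrite (bigD1 (Ordinal ltin)). Qed.

Section Lagrange.
Variables (K : fieldType).
Implicit Types (z : nat -> K) (p : {poly K}) (s : seq K).

Definition lagrange_term z n p i :=
  p.[z i] / \prod_(j < n | val j != i) (z i - z j).
(** For a polynomial [p], this is the sum of the residues of [p / \prod_(j < n)
    ('X - z j)] at the nodes, hence minus its residue at infinity: it depends
    only on the top coefficients of [p] and of the nodal polynomial. *)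
Definition lagrange_sum z n p := \sum_(i < n) lagrange_term z n p i.

Definition nodal s : {poly K} := \prod_(x <- s) ('X - x%:P).

Lemma size_nodal s : size (nodal s) = (size s).+1.
Proof. exact: size_prod_XsubC. Qed.

Lemma nodal_cons x s : nodal (x :: s) = ('X - x%:P) * nodal s.
Proof. exact: big_cons. Qed.

Lemma nodal_lead s : (nodal s)`_(size s) = 1.
Proof.
by have /monicP := monic_prod_XsubC s xpredT id; rewrite lead_coefE size_nodal.
Qed.

(** The boolean factor makes the formula true for the empty list, where the
    index truncates to [0]. *)
Lemma nodal_subcoef1 s :
  (nodal s)`_(size s).-1 *+ (0 < size s) = - \sum_(x <- s) x.
Proof.
elim: s => [|x s IHs]; first by rewrite big_nil oppr0.
rewrite nodal_cons big_cons mulrBl coefB coefXM coefCM /= nodal_lead.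
rewrite mulr1 mulr1n.
by rewrite opprD addrC -IHs; case: (s).
Qed.

(** Newton's formula [2 e_2 = p_1 ^ 2 - p_2], in a form free of division. As
    above, the boolean factor discards the truncated indices. *)
Lemma nodal_subcoef2 s :
  (nodal s)`_(size s).-2 *+ (1 < size s) *+ 2 =
  (\sum_(x <- s) x) ^+ 2 - \sum_(x <- s) x ^+ 2.
Proof.
elim: s => [|x s IHs]; first by rewrite /= !big_nil mulr0n; ring.
rewrite nodal_cons !big_cons mulrBl coefB coefXM coefCM /=.
have := nodal_subcoef1 s; move: IHs; case: s => [|y s] /=.
  by move=> _ _; rewrite !big_nil mulr0n; ring.
case: s => [|y' s] /=; rewrite ?mulr0n ?mulr1n => IH1 IH2.
  rewrite IH2; move: IH1; rewrite !big_seq1 => _; ring.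
rewrite IH2 mulrnBl IH1; ring.
Qed.

Lemma horner_nodal z n x : (nodal (mkseq z n)).[x] = \prod_(j < n) (x - z j).
Proof.
rewrite horner_prod big_mkseq_ord.
by apply: eq_bigr => j _; rewrite hornerXsubC.
Qed.

Variables (z : nat -> K) (n : nat).
Hypothesis z_inj : injective z.

(** Each Lagrange basis polynomial has degree [n - 1] and leading coefficient
    [1 / \prod_(j != i) (z i - z j)]; compare the coefficients of degree [n -
    1] in the interpolation formula. *)
Lemma lagrange_sum_coef p :
  (size p <= n)%N -> lagrange_sum z n p = p`_n.-1 *+ (0 < n).
Proof.
case: n => [|m] szp; first by rewrite /lagrange_sum big_ord0 mulr0n.
rewrite mulr1n {2}(lagrange_gen (ltn0Sn m) z_inj szp) coef_sum.
apply: eq_bigr => i _;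
  rewrite /lagrange_term coefCM lagrangeE //= coefCM horner_prod.
rewrite (eq_bigl (fun j => j != i)) => [|j]; last by rewrite val_eqE.
rewrite (eq_bigr _ (fun j _ => hornerXsubC _ _)).
congr (_ * _); rewrite -[LHS]mulr1; congr (_ * _).
have := monic_prod_XsubC [seq j <- index_enum 'I_m.+1 | j != i] xpredT
  (fun j => z (val j)).
rewrite big_filter => /monicP; rewrite lead_coefE.
have -> // : (size (\prod_(j < m.+1 | j != i) ('X - (z j)%:P))).-1 = m.
rewrite -big_filter size_prod_XsubC /= size_filter -sum1_count.
by rewrite sum1_card cardC1 card_ord.
Qed.

Let Z := mkseq z n.

(** The nodal polynomial vanishes at the nodes, so a numerator of larger degree
    can be reduced before [lagrange_sum_coef] is applied. *)
Lemma lagrange_sum_mod q p :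
  lagrange_sum z n (p + q * nodal Z) = lagrange_sum z n p.
Proof.
apply: eq_bigr => i _; rewrite /lagrange_term hornerD hornerM.
suff /rootP-> : root (nodal Z) (z i) by rewrite mulr0 addr0.
by rewrite root_prod_XsubC map_f // mem_iota ltn_ord.
Qed.

Lemma lagrange_sum_deg_pred s :
  (size s).+1 = n -> lagrange_sum z n (nodal s) = 1.
Proof.
by move=> szs; rewrite lagrange_sum_coef ?size_nodal -?szs //= nodal_lead.
Qed.

Lemma lagrange_sum_deg s : size s = n ->
  lagrange_sum z n (nodal s) = \sum_(i < n) z i - \sum_(x <- s) x.
Proof.
move=> szs; have szZ : size Z = n by rewrite size_mkseq.
have := lagrange_sum_mod 1 (nodal s - nodal Z); rewrite mul1r subrK => ->.
rewrite lagrange_sum_coef; last first.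
  apply/leq_sizeP => j; rewrite leq_eqVlt => /predU1P[<-|ltnj].
    by rewrite coefB -{1}szs -szZ !nodal_lead subrr.
  by rewrite coefB !nth_default ?subrr // size_nodal ?szs ?szZ.
rewrite coefB mulrnBl -{1 2}szs nodal_subcoef1 -{1 2}szZ nodal_subcoef1.
by rewrite opprK addrC big_mkseq_ord.
Qed.

(** With equal first power sums, two steps of the division by the nodal
    polynomial cost a single subtraction of ['X * nodal Z], and what remains in
    degree [n - 1] is a difference of second elementary symmetric functions. *)
Lemma lagrange_sum_deg_succ s : size s = n.+1 ->
  \sum_(x <- s) x = \sum_(i < n) z i ->
  lagrange_sum z n (nodal s) *+ 2 =
    \sum_(i < n) z i ^+ 2 - \sum_(x <- s) x ^+ 2.
Proof.
move=> szs sum1; have szZ : size Z = n by rewrite size_mkseq.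
have sumZ : \sum_(x <- Z) x = \sum_(i < n) z i by rewrite big_mkseq_ord.
have szZ0 : size (0 :: Z) = n.+1 by rewrite /= szZ.
have := lagrange_sum_mod 'X (nodal s - 'X * nodal Z); rewrite subrK => ->.
have -> : 'X * nodal Z = nodal (0 :: Z) by rewrite nodal_cons subr0.
rewrite lagrange_sum_coef; last first.
  apply/leq_sizeP => j; rewrite leq_eqVlt => /predU1P[<-|].
    have := nodal_subcoef1 s; have := nodal_subcoef1 (0 :: Z).
    rewrite szs szZ0 /= !mulr1n coefB => -> ->.
    by rewrite big_cons add0r sumZ sum1 subrr.
  rewrite leq_eqVlt => /predU1P[<-|ltnj].
    by rewrite coefB -{1}szs -szZ0 !nodal_lead subrr.
  by rewrite coefB !nth_default ?subrr // size_nodal ?szs ?szZ0.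
have := nodal_subcoef2 s; have := nodal_subcoef2 (0 :: Z).
rewrite szs szZ0 /= coefB !mulrnBl => -> ->.
rewrite !big_cons sumZ sum1 big_mkseq_ord; ring.
Qed.
End Lagrange.

(** * Partitions and single boxes *)

Section Parts.
Implicit Types (mu : seq nat) (k n i : nat).

Lemma sorted_geqP mu :
  reflect (forall i, nth 0 mu i.+1 <= nth 0 mu i)%N (sorted geq mu).
Proof.
apply: (iffP idP) => [smu i|H].
  have [lt|le] := ltnP i.+1 (size mu); last by rewrite nth_default.
  by have /(sortedP 0%N) := smu; apply.
by apply/(sortedP 0%N) => i _; apply: H.
Qed.

Lemma sumn_nth k mu : (size mu <= k)%N -> sumn mu = (\sum_(i < k) nth 0 mu i)%N.
Proof.
move=> szk; rewrite sumnE (big_nth 0%N) big_mkord.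
rewrite (big_ord_widen k (nth 0%N mu)) // big_mkcond.
by apply: eq_bigr => i _; case: ltnP => // le; rewrite nth_default.
Qed.

Lemma sumn_incr_nth mu i : sumn (incr_nth mu i) = (sumn mu).+1.
Proof.
elim: mu i => [|x s IHs] [|i] //=; last by rewrite IHs addnS.
by elim: i => [|i IHi].
Qed.

Lemma addable_neq mu i j : sorted geq (incr_nth mu i) -> j.+1 = i ->
  nth 0%N mu j != nth 0%N mu i.
Proof.
move=> /sorted_geqP/(_ j) + ji; rewrite -ji !nth_incr_nth eqxx gtn_eqF //.
by rewrite add0n add1n => lt; rewrite gtn_eqF.
Qed.

Lemma not_addable mu i : sorted geq mu -> ~~ sorted geq (incr_nth mu i) ->
  exists2 j, i = j.+1 & nth 0%N mu j = nth 0%N mu i.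
Proof.
move=> /sorted_geqP smu; case: i => [|i] nadd.
  case/negP: nadd; apply/sorted_geqP => i; rewrite !nth_incr_nth.
  by have := smu i; case: i => [|i] /=; lia.
exists i => //; apply/eqP; rewrite eqn_leq smu andbT leqNgt.
apply/negP => lt; case/negP: nadd; apply/sorted_geqP => j.
rewrite !nth_incr_nth eqSS; have := smu j.
by case: eqP => [<-|_]; case: eqP => [|_]; lia.
Qed.

Lemma nth_sorted_eq0 mu k : sorted geq mu -> (sumn mu < k)%N -> size mu = k ->
  nth 0%N mu k.-1 = 0%N.
Proof.
move=> smu ltk szmu; apply/eqP; rewrite -leqn0 leqNgt; apply/negP => pos.
have : (\sum_(i < k) 1 <= \sum_(i < k) nth 0 mu i)%N.
  apply: leq_sum => i _; apply: leq_trans pos _.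
  have : (i <= k.-1)%N by have := ltn_ord i; lia.
  move: (nat_of_ord i) (k.-1) => a b; elim: b => [|b IHb].
    by rewrite leqn0 => /eqP->.
  rewrite leq_eqVlt => /predU1P[->//|/IHb]; apply: leq_trans.
  exact: (sorted_geqP _ smu).
by rewrite -sumn_nth ?szmu // sum1_card card_ord leqNgt ltk.
Qed.

Definition decr_nth mu j := set_nth 0%N mu j (nth 0 mu j).-1.

Lemma nth_decr_nth mu j i :
  nth 0%N (decr_nth mu j) i = (nth 0 mu i - (j == i))%N.
Proof.
rewrite /decr_nth nth_set_nth /= [j == i]eq_sym.
by case: eqP => [->|_]; rewrite ?subn1 ?subn0.
Qed.

Lemma removable_ltn_size mu j :
  (nth 0 mu j.+1 < nth 0 mu j)%N -> (j < size mu)%N.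
Proof. by apply: contraTT; rewrite -!leqNgt => le; rewrite nth_default. Qed.

Lemma exists_removable mu : (0 < sumn mu)%N ->
  exists j, (nth 0 mu j.+1 < nth 0 mu j)%N.
Proof.
have [/existsP[j rem] _|] :=
  boolP [exists j : 'I_(size mu), (nth 0 mu j.+1 < nth 0 mu j)%N].
  by exists j.
rewrite negb_exists => /forallP norem.
have up i : (nth 0 mu i <= nth 0 mu i.+1)%N.
  have [lt|le] := ltnP i (size mu); last by rewrite nth_default.
  by rewrite leqNgt (norem (Ordinal lt)).
have up_add i m : (nth 0 mu i <= nth 0 mu (i + m))%N.
  by elim: m => [|m IHm]; rewrite ?addn0 // addnS (leq_trans IHm).
rewrite (sumn_nth (leqnn _)) big1 // => i _; apply/eqP; rewrite -leqn0.
rewrite -[X in (_ <= X)%N](nth_default 0%N (leq_addl i (size mu))).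
exact: up_add.
Qed.

Lemma decr_nthK mu j : (nth 0 mu j.+1 < nth 0 mu j)%N ->
  incr_nth (decr_nth mu j) j = mu.
Proof.
move=> rem; have ltj := removable_ltn_size rem.
apply: (@eq_from_nth _ 0%N).
  by rewrite size_incr_nth size_set_nth (maxn_idPr ltj) ltj.
by move=> i _; rewrite nth_incr_nth nth_decr_nth; case: eqP => [<-|]; lia.
Qed.

Lemma sorted_decr_nth mu j : sorted geq mu -> (nth 0 mu j.+1 < nth 0 mu j)%N ->
  sorted geq (decr_nth mu j).
Proof.
move=> /sorted_geqP smu lt; apply/sorted_geqP => i; rewrite !nth_decr_nth.
by have := smu i; case: (j =P i) lt => [<-|_]; case: eqP => _; lia.
Qed.

Lemma size_decr_nth mu j :
  (nth 0 mu j.+1 < nth 0 mu j)%N -> size (decr_nth mu j) = size mu.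
Proof.
by move/removable_ltn_size => ltj; rewrite size_set_nth; apply/maxn_idPr.
Qed.

Lemma incr_nthK mu j : (j < size mu)%N -> decr_nth (incr_nth mu j) j = mu.
Proof.
move=> ltj; apply: (@eq_from_nth _ 0%N).
  by rewrite size_set_nth size_incr_nth ltj; apply/maxn_idPr.
by move=> i _; rewrite nth_decr_nth nth_incr_nth addKn.
Qed.

(** The partitions of [n] with at most [k] parts, padded with zeros to exactly
    [k] of them. Decoupling [k] from [n] lets the partitions of [n] and of [n +
    1] be compared as lists of the same length. *)
Definition partitions k n : seq (seq nat) :=
  [seq s <- [seq [seq val a | a <- t] | t : k.-tuple 'I_n.+1]
     | sorted geq s && (sumn s == n)].

Lemma mem_partitions k n s :
  (s \in partitions k n) = [&& size s == k, sorted geq s & sumn s == n].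
Proof.
rewrite mem_filter [RHS]andbC; case: (boolP (sorted geq s && _)) => //=.
case/andP=> _ /eqP sums; apply/mapP/eqP => [[t _ ->]|szs].
  by rewrite size_map size_tuple.
have szt : size [seq inord a : 'I_n.+1 | a <- s] == k by rewrite size_map szs.
exists (Tuple szt); first exact: mem_enum.
rewrite /= -map_comp -[LHS]map_id; apply/eq_in_map => a sa /=.
rewrite inordK // ltnS -sums (perm_sumn (perm_to_rem sa)).
exact: leq_addr.
Qed.

Lemma uniq_partitions k n : uniq (partitions k n).
Proof.
apply: filter_uniq; rewrite map_inj_uniq ?enum_uniq // => t t' tt'.
by apply: val_inj; apply: inj_map tt'; apply: val_inj.
Qed.

(** A partition of [n] has at most [n] parts, so further rows only add a zero.
    *)
Lemma perm_partitions_rcons k n : (n <= k)%N ->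
  perm_eq (partitions k.+1 n) [seq rcons s 0%N | s <- partitions k n].
Proof.
move=> lenk; apply: uniq_perm; first exact: uniq_partitions.
  by rewrite map_inj_uniq ?uniq_partitions //; apply: rcons_injl.
move=> s; rewrite mem_partitions; apply/and3P/mapP.
  case=> /eqP szs ss /eqP sums.
  case/lastP: s szs ss sums => [//|s x] szs ss sums.
  move: (szs); rewrite size_rcons => -[szk].
  have x0 : x = 0%N.
    have := nth_sorted_eq0 ss _ szs.
    by rewrite sums ltnS lenk nth_rcons szk ltnn eqxx => ->.
  move: ss sums; rewrite {}x0 => ss sums {szs}.
  exists s => //;
    rewrite mem_partitions szk eqxx -sums sumn_rcons addn0 eqxx andbT.
  by apply: subseq_sorted ss; [move=> a b c /=; lia | apply: subseq_rcons].
case=> t; rewrite mem_partitions =>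
  /and3P[/eqP szt /sorted_geqP st /eqP sums] ->.
split; rewrite ?size_rcons ?szt ?sumn_rcons ?sums ?addn0 //.
apply/sorted_geqP => i; rewrite !nth_rcons.
case: ltnP => h1; case: ltnP => h2; rewrite ?st //; first lia.
  by case: eqP.
by do 2!case: eqP.
Qed.

Definition growths k n : seq (seq nat * nat) :=
  [seq (incr_nth mu i, i) | mu <- partitions k n,
       i <- [seq i <- iota 0 k | sorted geq (incr_nth mu i)]].

(** The edges of Young's graph between levels [n] and [n + 1] can be listed
    from above, as removable boxes of [nu], or from below, as addable boxes of
    [mu]. This is the exchange of summation behind the recursion. *)
Lemma perm_growths k n :
  perm_eq [seq (nu, j) | nu <- partitions k n.+1,
            j <- [seq j <- iota 0 k | (nth 0 nu j.+1 < nth 0 nu j)%N]]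
          (growths k n).
Proof.
apply: uniq_perm.
- apply: allpairs_uniq_dep; first exact: uniq_partitions.
    by move=> nu _; apply/filter_uniq/iota_uniq.
  by move=> [a b] [c d] _ _ /= [-> ->].
- apply: allpairs_uniq_dep; first exact: uniq_partitions.
    by move=> nu _; apply/filter_uniq/iota_uniq.
  move=> [a i] [b j] /allpairsPdep[a' [i' []]].
  rewrite mem_partitions mem_filter mem_iota => /and3P[/eqP sza _ _].
  case/andP=> _ /= ltik [ea ei] /allpairsPdep[b' [j' []]].
  rewrite mem_partitions mem_filter mem_iota => /and3P[/eqP szb _ _].
  case/andP=> _ /= ltjk [eb ej] [eab eij]; subst.
  by rewrite -(incr_nthK ltik) eab incr_nthK ?szb.
move=> [nu i]; apply/allpairsPdep/allpairsPdep.
  case=> nu' [j []]; rewrite mem_partitions mem_filter mem_iota add0n /=.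
  case/and3P=> /eqP sznu snu /eqP sumnu /andP[rem ltjk] [-> ->].
  exists (decr_nth nu' j), j;
    rewrite mem_partitions mem_filter mem_iota decr_nthK //.
  rewrite size_decr_nth // sznu eqxx sorted_decr_nth // snu ltjk.
  by rewrite -eqSS -sumnu -{2}(decr_nthK rem) sumn_incr_nth eqxx.
case=> mu [j []]; rewrite mem_partitions mem_filter mem_iota add0n /=.
case/and3P=> /eqP szmu smu /eqP summu /andP[add ltjk] [-> ->].
exists (incr_nth mu j), j; rewrite mem_partitions mem_filter mem_iota add0n.
rewrite size_incr_nth szmu ltjk add sumn_incr_nth summu !eqxx /=; split=> //.
rewrite andbT !nth_incr_nth eqxx ltn_eqF //.
by have /sorted_geqP/(_ j) := smu; rewrite ltnS.
Qed.
End Parts.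

(** * The ring of virtual characters *)

Section BigDom.
Variables (T : Type) (idx : T) (op : Monoid.com_law idx).
Variable F : weight -> int -> T.
Hypothesis F0 : forall x, F x 0 = idx.
Implicit Types V W : vchar.

(** Euler and Chern classes, products and duals of characters are all defined
    as iterated operations over the support. Enlarging the index set to a
    common list is what makes them comparable on a sum of characters. *)
Lemma big_dom V s : uniq s -> {subset dom V <= s} ->
  \big[op/idx]_(x <- dom V) F x (coeff x V) =
  \big[op/idx]_(x <- s) F x (coeff x V).
Proof.
move=> Us sVs; rewrite [RHS](bigID (mem (dom V))) /=.
rewrite [X in op _ X]big1 ?Monoid.mulm1.
  rewrite -[RHS]big_filter; apply: perm_big; apply: uniq_perm.
  - exact: uniq_dom.
  - exact: filter_uniq.
  by move=> x; rewrite mem_filter; case: (boolP (x \in dom V)) => // /sVs ->.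
by move=> x xV; rewrite coeff_outdom.
Qed.

Hypothesis FD : forall x a b, F x (a + b) = op (F x a) (F x b).

Lemma big_domD V W :
  \big[op/idx]_(x <- dom (V + W)) F x (coeff x (V + W)) =
  op (\big[op/idx]_(x <- dom V) F x (coeff x V))
     (\big[op/idx]_(x <- dom W) F x (coeff x W)).
Proof.
pose s := undup (dom V ++ dom W).
have Us : uniq s by apply: undup_uniq.
have sV : {subset dom V <= s} by move=> x; rewrite mem_undup mem_cat => ->.
have sW : {subset dom W <= s}.
  by move=> x; rewrite mem_undup mem_cat orbC => ->.
have sD : {subset dom (V + W) <= s}.
  by move=> x /domD_subset; rewrite mem_undup.
rewrite (big_dom Us sV) (big_dom Us sW) (big_dom Us sD) -big_split.
by apply: eq_bigr => x _; rewrite coeffD FD.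
Qed.
End BigDom.

Section GroupRing.
Implicit Types (U V W : vchar) (x y : weight).

Lemma freegU_mulrz k x : << k *g x >> = << x >> *~ k :> vchar.
Proof. by rewrite freeg_mulz; congr << _ *g _ >>; rewrite intz. Qed.

(** Weights generate the group of characters, so an identity between additive
    operations need only be checked on weights. *)
Lemma vchar_ind (P : vchar -> Prop) :
  (forall V W, P V -> P W -> P (V - W)) -> (forall x, P << x >>) ->
  forall V, P V.
Proof.
move=> PB Pm V.
have P0 : P 0 by rewrite -(subrr << 0 : weight >>); apply: PB.
have PN W : P W -> P (- W) by rewrite -sub0r; apply: PB.
have PD W W' : P W -> P W' -> P (W + W').
  by move=> PW PW'; rewrite -[W']opprK; apply: PB => //; apply: PN.
have Pn n x : P (<< x >> *+ n).
  by elim: n => [|n IHn]; rewrite ?mulr0n // mulrS; apply: PD.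
rewrite -(freeg_sumE V); elim/big_ind: _ => // x _; rewrite freegU_mulrz.
by case: (coeff x V) => n; rewrite ?NegzE ?mulrNz -pmulrn; [|apply: PN].
Qed.

Lemma vmulDl : left_distributive vmul +%R.
Proof.
move=> U V W; rewrite /vmul.
pose F x a : vchar := \sum_(y <- dom W) << a * coeff y W *g x + y >>.
apply: (@big_domD _ _ _ F) => [x|x a b]; rewrite /F.
  by apply: big1 => y _; rewrite mul0r freegU0.
by rewrite -big_split; apply: eq_bigr => y _; rewrite /= freegUD mulrDl.
Qed.

Lemma vmulC : commutative vmul.
Proof.
move=> V W; rewrite /vmul exchange_big; apply: eq_bigr => x _.
by apply: eq_bigr => y _; rewrite addrC mulrC.
Qed.

Lemma vmulBl U V W : vmul (U - V) W = vmul U W - vmul V W.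
Proof. by apply: (addIr (vmul V W)); rewrite -vmulDl !subrK. Qed.

Lemma vmulBr U V W : vmul U (V - W) = vmul U V - vmul U W.
Proof. by rewrite vmulC vmulBl !(vmulC U). Qed.

Lemma vmulU x y : vmul << x >> << y >> = << x + y >>.
Proof. by rewrite /vmul !domU1 !big_seq1 !coeffU !eqxx. Qed.

Lemma vmulA : associative vmul.
Proof.
move=> U V W; elim/vchar_ind: U => [U U' IH IH'|x].
  by rewrite !vmulBl IH IH'.
elim/vchar_ind: V => [V V' IH IH'|y];
  first by rewrite vmulBr !vmulBl vmulBr IH IH'.
elim/vchar_ind: W => [W W' IH IH'|z]; first by rewrite !vmulBr IH IH'.
by rewrite !vmulU addrA.
Qed.

Lemma vmul1 : left_id ch1 vmul.
Proof.
elim/vchar_ind=> [V W IH IH'|x]; first by rewrite vmulBr IH IH'.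
by rewrite vmulU add0r.
Qed.

Lemma ch1_neq0 : ch1 != 0.
Proof. by rewrite freegU_eq0. Qed.

HB.instance Definition _ := GRing.Zmodule_isComNzRing.Build vchar
  vmulA vmulC vmul1 vmulDl ch1_neq0.

Lemma vmulE V W : vmul V W = V * W.
Proof. by []. Qed.

Lemma freegU_mul x y : << x >> * << y >> = << x + y >> :> vchar.
Proof. exact: vmulU. Qed.

Lemma vdualD V W : vdual (V + W) = vdual V + vdual W.
Proof.
apply: (@big_domD _ _ _ (fun x a => << a *g - x >>)) => [x|x a b].
  exact: freegU0.
by rewrite /= freegUD.
Qed.

Lemma vdual_is_zmod_morphism : zmod_morphism vdual.
Proof. by move=> V W; apply: (addIr (vdual W)); rewrite -vdualD !subrK. Qed.

HB.instance Definition _ := GRing.isZmodMorphism.Build vchar vchar vdual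
  vdual_is_zmod_morphism.

Lemma vdualU x : vdual << x >> = << - x >>.
Proof. by rewrite /vdual domU1 big_seq1 coeffU eqxx. Qed.

Lemma vdual_is_monoid_morphism : monoid_morphism vdual.
Proof.
split; first by rewrite vdualU oppr0.
elim/vchar_ind=> [U U' IH IH' W|x];
  first by rewrite mulrBl !raddfB /= mulrBl IH IH'.
elim/vchar_ind=> [W W' IH IH'|y];
  first by rewrite mulrBr !raddfB /= mulrBr IH IH'.
by rewrite freegU_mul !vdualU freegU_mul opprD.
Qed.

HB.instance Definition _ := GRing.isMonoidMorphism.Build vchar vchar vdual
  vdual_is_monoid_morphism.

Lemma vdualK : involutive vdual.
Proof.
elim/vchar_ind=> [V W IH IH'|x]; first by rewrite !raddfB /= IH IH'.
by rewrite !vdualU opprK.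
Qed.

Lemma coeff_sumU (I : Type) (r : seq I) (f : I -> weight) x :
  coeff x (\sum_(i <- r) << f i >> : vchar) =
  (count (fun i => f i == x) r)%:R.
Proof.
rewrite raddf_sum /= -sum1_count natr_sum [RHS]big_mkcond.
by apply: eq_bigr => i _; rewrite coeffU mul1r; case: eqP.
Qed.

End GroupRing.

(** * Corner characters *)

Section Corners.
Implicit Types mu : seq nat.

Definition outer_wt mu i : weight := ((nth 0%N mu i)%:Z, i%:Z, 0).
Definition inner_wt mu i : weight := ((nth 0%N mu i)%:Z, i.+1%:Z, 0).
Definition diag_wt : weight := (1, 1, 0).

(** The lattice points [(mu_i, i)] and [(mu_i, i + 1)] are the ends of the
    vertical edges of the boundary of [mu]. When two consecutive rows have the
    same length, the end of one edge is the start of the next one, and the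
    terms cancel; after cancellation the first sum runs over the addable cells
    (minimal generators of the monomial ideal) and the second one over the
    relations between them. The uncancelled form has the advantage that its
    terms are indexed by all rows. *)
Definition corner_char mu : vchar :=
  \sum_(i < (size mu).+1) << outer_wt mu i >>
  - \sum_(i < size mu) << inner_wt mu i >>.

(** The K-theoretic Euler class of the cotangent space at the origin;
    multiplying by it turns a sum over cells into a sum over corners. *)
Definition koszul : vchar := (1 - t1) * (1 - t2).

Lemma mon_exp (a b : nat) : mon a b 0 = t1 ^+ a * t2 ^+ b.
Proof.
have e1 n : t1 ^+ n = mon n 0 0.
  by elim: n => // n IHn; rewrite exprS IHn freegU_mul /=;
     congr << (_, _, _) >>.
have e2 n : t2 ^+ n = mon 0 n 0.
  by elim: n => // n IHn; rewrite exprS IHn freegU_mul /=;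
     congr << (_, _, _) >>; rewrite ?addr0 ?add0r.
by rewrite e1 e2 freegU_mul; congr << (_, _, _) >>; rewrite ?addr0 ?add0r.
Qed.

Lemma vdual_Qchar mu : vdual (Qchar mu) =
  \sum_(i < size mu) t2 ^+ i * \sum_(j < nth 0%N mu i) t1 ^+ j.
Proof.
rewrite /Qchar raddf_sum big_allpairs_dep /=.
rewrite -(big_mkord xpredT (fun i =>
  t2 ^+ i * \sum_(j < nth 0%N mu i) t1 ^+ j)).
rewrite /index_iota subn0; apply: eq_bigr => i _.
rewrite -(big_mkord xpredT (fun j => t1 ^+ j)) /index_iota subn0 mulr_sumr.
by apply: eq_bigr => j _; rewrite vdual_mon !opprK oppr0 mon_exp mulrC.
Qed.

(** In each row the geometric sum over the cells telescopes under [1 - t1],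
    which leaves the two ends of the row; the factor [1 - t2] then splits the
    right end into an outer and an inner corner. *)
Lemma corner_charE mu : corner_char mu = 1 - koszul * vdual (Qchar mu).
Proof.
have outE i : << outer_wt mu i >> = t1 ^+ nth 0%N mu i * t2 ^+ i :> vchar.
  by rewrite -mon_exp.
have innE i : << inner_wt mu i >> = t1 ^+ nth 0%N mu i * t2 ^+ i.+1 :> vchar.
  by rewrite -mon_exp.
have geom (t : vchar) n : (1 - t) * \sum_(i < n) t ^+ i = 1 - t ^+ n.
  by rewrite -(opprB t) mulNr -subrX1 opprB.
have -> : koszul * vdual (Qchar mu) =
    (1 - t2) * \sum_(i < size mu) t2 ^+ i
    - (1 - t2) * \sum_(i < size mu) << outer_wt mu i >>.
  rewrite -mulrBr /koszul [(1 - t1) * _]mulrC -mulrA; congr (_ * _).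
  rewrite vdual_Qchar -sumrB mulr_sumr; apply: eq_bigr => i _.
  rewrite mulrCA geom outE; ring.
have -> : corner_char mu = t2 ^+ size mu +
    (1 - t2) * \sum_(i < size mu) << outer_wt mu i >>.
  rewrite /corner_char big_ord_recr /= outE nth_default // mul1r addrAC addrC.
  congr (_ + _); rewrite mulrBl mul1r; congr (_ - _).
  rewrite mulr_sumr; apply: eq_bigr => i _.
  by rewrite innE outE mulrCA exprS.
rewrite geom; ring.
Qed.

Lemma Qchar_incr mu i : (i < size mu)%N ->
  Qchar (incr_nth mu i) = Qchar mu + << - outer_wt mu i >>.
Proof.
move=> ltik; apply: (can_inj vdualK).
rewrite raddfD /= vdualU opprK !vdual_Qchar size_incr_nth ltik.
rewrite (bigD1 (Ordinal ltik)) //= [in RHS](bigD1 (Ordinal ltik)) //=.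
rewrite nth_incr_nth eqxx big_ord_recr /= mulrDr.
have -> : << outer_wt mu i >> = t2 ^+ i * t1 ^+ nth 0%N mu i :> vchar.
  by rewrite mulrC -mon_exp.
rewrite addrAC; congr (_ + _ + _); apply: eq_bigr => j.
rewrite -val_eqE /= => /negbTE neji.
by rewrite nth_incr_nth eq_sym neji.
Qed.

(** Expand the quadratic expression of the virtual tangent space at [Q + b^-1].
    The two cross terms contain [koszul] times [Q] or its dual, which
    [corner_charE] rewrites through the corners. *)
Lemma Tvir_incr mu i : (i < size mu)%N ->
  Tvir (incr_nth mu i) - Tvir mu =
    << - outer_wt mu i >> * corner_char mu
    + << outer_wt mu i + diag_wt >> * vdual (corner_char mu)
    - << outer_wt mu i + diag_wt >> - koszul.
Proof.
move=> ltik; rewrite /Tvir !vmulE -/koszul.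
rewrite Qchar_incr // raddfD /= vdualU opprK corner_charE.
have -> : vdual (1 - koszul * vdual (Qchar mu)) = 1 - vdual koszul * Qchar mu.
  by rewrite rmorphB rmorph1 rmorphM /= vdualK.
(* Serre duality on the plane: dualizing the Koszul class twists it by the
   weight of the canonical bundle. *)
have -> : vdual koszul = << - diag_wt >> * koszul.
  rewrite rmorphM !rmorphB !rmorph1 /= !vdual_mon oppr0.
  have -> : << - diag_wt >> = mon (-1) 0 0 * mon 0 (-1) 0 :> vchar.
    by rewrite freegU_mul.
  have tt' : mon (-1) 0 0 * t1 = 1 by rewrite freegU_mul.
  have uu' : mon 0 (-1) 0 * t2 = 1 by rewrite freegU_mul.
  transitivity ((mon (-1) 0 0 * t1 - mon (-1) 0 0) *
    (mon 0 (-1) 0 * t2 - mon 0 (-1) 0)).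
    by rewrite tt' uu'.
  rewrite /koszul; ring.
have bb : << outer_wt mu i >> * << - outer_wt mu i >> = 1 :> vchar.
  by rewrite freegU_mul subrr.
have cc : << diag_wt >> * << - diag_wt >> = 1 :> vchar.
  by rewrite freegU_mul subrr.
rewrite -freegU_mul.
move: bb cc; set b := << outer_wt mu i >>; set b' := << - outer_wt mu i >>.
set c := << diag_wt >>; set c' := << - diag_wt >>; set Q := Qchar mu;
  set Q' := vdual Q.
move=> bb cc.
transitivity (b' * (1 - koszul * Q') - b * koszul * Q - (b * b') * koszul);
  first by ring.
transitivity (b' * (1 - koszul * Q') - (c * c') * b * koszul * Q - koszul);
  last by ring.
by rewrite bb cc !mul1r.
Qed.
End Corners.

(** * Localization over generic weights *)

Section Localization.
Variables (K : fieldType) (l1 l2 w : K).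
Local Notation c1 := (c1w l1 l2 w).
Hypothesis c1_inj0 : forall x, c1 x = 0 -> x = 0.
Hypothesis c1D1_neq0 : forall x, 1 + c1 x != 0.
Implicit Types (mu : seq nat) (V W : vchar) (x y : weight).

Lemma c1D x y : c1 (x + y) = c1 x + c1 y.
Proof. by rewrite /c1w /= !mulrzDr; ring. Qed.

Lemma c1N x : c1 (- x) = - c1 x.
Proof. by rewrite /c1w /= !mulrNz; ring. Qed.

Lemma c1B x y : c1 (x - y) = c1 x - c1 y.
Proof. by rewrite c1D c1N. Qed.

(** The Euler class of a character is multiplicative only in the absence of the
    zero weight, whose Chern class is not invertible. Replacing that one factor
    by [1] gives a multiplicative class, and the two agree on [Tvir] because
    the fixed part of the virtual tangent space vanishes ([coeff0_Tvir]). *)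
Definition moving x : K := if x == 0 then 1 else c1 x.

Lemma moving_neq0 x : moving x != 0.
Proof.
rewrite /moving; case: (x =P 0) => [_|x0]; first exact: oner_neq0.
by apply/eqP => /c1_inj0.
Qed.

Lemma movingE x : x != 0 -> moving x = c1 x.
Proof. by rewrite /moving => /negbTE ->. Qed.

Definition euler_moving V : K := \prod_(x <- dom V) moving x ^ coeff x V.

Lemma euler_movingE V : coeff 0 V = 0 -> euler l1 l2 w V = euler_moving V.
Proof.
move=> V0; rewrite /euler /euler_moving !big_seq; apply: eq_bigr => x.
rewrite mem_dom => xV; rewrite movingE //; apply: contra_neq xV => ->.
by [].
Qed.

Lemma euler_movingD V W :
  euler_moving (V + W) = euler_moving V * euler_moving W.
Proof.
apply: (big_domD (F := fun x a => moving x ^ a)) => [x|x a b].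
  exact: expr0z.
by rewrite expfzDr // moving_neq0.
Qed.

Lemma euler_moving0 : euler_moving 0 = 1.
Proof. by rewrite /euler_moving dom0 big_nil. Qed.

Lemma euler_moving_neq0 V : euler_moving V != 0.
Proof.
have := euler_movingD V (- V); rewrite subrr euler_moving0 => /esym VN.
by apply: contraTneq (oner_neq0 K) => V0; rewrite -VN V0 mul0r eqxx.
Qed.

Lemma euler_movingN V : euler_moving (- V) = (euler_moving V)^-1.
Proof.
apply: (mulfI (euler_moving_neq0 V)); rewrite mulfV ?euler_moving_neq0 //.
by rewrite -euler_movingD subrr euler_moving0.
Qed.

Lemma euler_movingU x : euler_moving << x >> = moving x.
Proof. by rewrite /euler_moving domU1 big_seq1 coeffU eqxx. Qed.

Lemma euler_moving_sum (I : Type) (r : seq I) (f : I -> weight) :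
  euler_moving (\sum_(i <- r) << f i >>) = \prod_(i <- r) moving (f i).
Proof.
rewrite (big_morph euler_moving euler_movingD euler_moving0).
by apply: eq_bigr => i _; rewrite euler_movingU.
Qed.

Lemma chernD V W : chern l1 l2 w (V + W) = chern l1 l2 w V * chern l1 l2 w W.
Proof.
apply: (big_domD (F := fun x a => (1 + c1 x) ^ a)) => [x|x a b].
  exact: expr0z.
by rewrite expfzDr.
Qed.

Lemma chernU x : chern l1 l2 w << x >> = 1 + c1 x.
Proof. by rewrite /chern domU1 big_seq1 coeffU eqxx. Qed.

Lemma c1_t1 : c1 (1, 0, 0) = l1.
Proof. by rewrite /c1w /=; ring. Qed.

Lemma c1_t2 : c1 (0, 1, 0) = l2.
Proof. by rewrite /c1w /=; ring. Qed.

Lemma l1_neq0 : l1 != 0.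
Proof. by rewrite -c1_t1; apply/eqP => /c1_inj0. Qed.

Lemma l2_neq0 : l2 != 0.
Proof. by rewrite -c1_t2; apply/eqP => /c1_inj0. Qed.

(** * Residues at the corners *)

Definition outer_c1 mu i : K := c1 (outer_wt mu i).
Definition inner_c1 mu i : K := c1 (inner_wt mu i).
Local Notation L := (l1 + l2).

Lemma outer_c1E mu i : outer_c1 mu i = l1 *+ nth 0%N mu i + l2 *+ i.
Proof. by rewrite /outer_c1 /c1w /= mulr0z addr0 -!pmulrn. Qed.

Lemma inner_c1E mu i : inner_c1 mu i = outer_c1 mu i + l2.
Proof.
by rewrite outer_c1E /inner_c1 /c1w /= mulr0z addr0 -!pmulrn mulrSr addrA.
Qed.

Lemma c1_inj x y : c1 x = c1 y -> x = y.
Proof.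
move=> /eqP; rewrite -subr_eq0 -c1B => /eqP/c1_inj0/eqP.
by rewrite subr_eq0 => /eqP.
Qed.

(** Distinct rows give distinct corners even before cancellation: the second
    coordinate of the weight is the row. *)
Lemma outer_c1_inj mu : injective (outer_c1 mu).
Proof. by move=> i j /c1_inj[]. Qed.

Lemma inner_c1_inj mu : injective (inner_c1 mu).
Proof. by move=> i j /c1_inj[]. Qed.

Definition outer_pts mu k := mkseq (outer_c1 mu) k.+1.
Definition inner_pts mu k := mkseq (inner_c1 mu) k.

(** With [F u = \prod_(i <= k) (u - x_i) / \prod_(j < k) (u - y_j)], where
    [x_i] and [y_j] are the Chern classes of the outer and inner corners, this
    is the residue of [1 / F] at [x_i]. It vanishes unless a box can be added
    in row [i]. *)
Definition up_weight mu k i :=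
  lagrange_term (outer_c1 mu) k.+1 (nodal (inner_pts mu k)) i.

(** The residue at [y_j] of the same function [F]; it vanishes unless a box can
    be removed from row [j]. *)
Definition down_weight mu k j :=
  lagrange_term (inner_c1 mu) k (nodal (outer_pts mu k)) j.

(** Together with [corners_power_sum2], this gives the expansion of [F] at
    infinity: [F u = u + l1 l2 |mu| / u] up to higher powers of [1 / u]. *)
Lemma corners_power_sum1 mu k : size mu = k ->
  \sum_(i < k.+1) outer_c1 mu i = \sum_(j < k) inner_c1 mu j.
Proof.
move=> szmu; rewrite big_ord_recr /=; under [RHS]eq_bigr do rewrite inner_c1E.
rewrite [in RHS]big_split /= sumr_const card_ord.
by rewrite outer_c1E nth_default ?szmu // mulr0n add0r.
Qed.

Lemma corners_power_sum2 mu k : size mu = k ->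
  \sum_(j < k) inner_c1 mu j ^+ 2 - \sum_(i < k.+1) outer_c1 mu i ^+ 2 =
  l1 * l2 *+ sumn mu *+ 2.
Proof.
move=> szmu; rewrite big_ord_recr /= opprD addrA -sumrB.
have -> : sumn mu = (\sum_(i < k) nth 0 mu i)%N.
  by apply: sumn_nth; rewrite szmu.
rewrite outer_c1E nth_default ?szmu // mulr0n add0r => {szmu}.
elim: k => [|k IHk]; first by rewrite !big_ord0; ring.
rewrite !big_ord_recr /= mulrnDr mulrnDl -IHk inner_c1E outer_c1E.
rewrite mulrSr -[l2 *+ k]mulr_natl -[l1 *+ _]mulr_natl
  -[_ *+ nth _ _ _]mulr_natl.
ring.
Qed.

(** The sum of the residues of [F], read off from its expansion at infinity. *)
Lemma down_sum mu k : size mu = k -> 2%:R != 0 :> K ->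
  \sum_(j < k) down_weight mu k j = l1 * l2 *+ sumn mu.
Proof.
move=> szmu two0; apply: (mulIf two0);
  rewrite !mulr_natr -(corners_power_sum2 szmu).
rewrite -(big_mkseq_ord _ _ (outer_c1 mu) k.+1 (fun c => c ^+ 2)).
apply: lagrange_sum_deg_succ => //; first exact: inner_c1_inj.
  by rewrite size_mkseq.
by rewrite big_mkseq_ord corners_power_sum1.
Qed.

(** A quadratic polynomial in [x_i] involves only the first three moments of
    the residues, which are the first three coefficients of the expansion of [1
    / F] at infinity: [1], [0] and [- l1 l2 |mu|]. *)
Lemma up_moments mu k (a b : K) : size mu = k -> 2%:R != 0 :> K ->
  \sum_(i < k.+1) (a - outer_c1 mu i) * (b + outer_c1 mu i) * up_weight mu k i =
  a * b + l1 * l2 *+ sumn mu.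
Proof.
move=> szmu two0.
have sumI (f : K -> K) : \sum_(c <- inner_pts mu k) f c =
  \sum_(j < k) f (inner_c1 mu j).
  exact: big_mkseq_ord.
have szI : size (inner_pts mu k) = k by rewrite size_mkseq.
have m0 : \sum_(i < k.+1) up_weight mu k i = 1.
  by apply: lagrange_sum_deg_pred; rewrite ?szI //; apply: outer_c1_inj.
have m1 : \sum_(i < k.+1) outer_c1 mu i * up_weight mu k i = 0.
  (* Multiplying the numerator by a power of the variable amounts to adding
     zeros to the list of its roots. *)
  have := @lagrange_sum_deg K (outer_c1 mu) k.+1 (@outer_c1_inj mu)
    (0 :: inner_pts mu k).
  rewrite /= szI big_cons (sumI id) -(corners_power_sum1 szmu) add0r subrr => E.
  rewrite -[RHS]E // /lagrange_sum; apply: eq_bigr => i _.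
  by rewrite /up_weight /lagrange_term nodal_cons subr0 hornerM hornerX mulrA.
have m2 : \sum_(i < k.+1) outer_c1 mu i ^+ 2 * up_weight mu k i =
  - (l1 * l2 *+ sumn mu).
  have := @lagrange_sum_deg_succ K (outer_c1 mu) k.+1 (@outer_c1_inj mu)
    [:: 0, 0 & inner_pts mu k].
  rewrite /= szI !big_cons (sumI id) (sumI (fun c => c ^+ 2))
    -(corners_power_sum1 szmu).
  rewrite !add0r expr0n /= !add0r => /(_ erefl erefl) E.
  apply: (mulIf two0);
    rewrite !mulr_natr mulNrn -(corners_power_sum2 szmu) opprB -E.
  congr (_ *+ 2); rewrite /lagrange_sum; apply: eq_bigr => i _.
  by rewrite /up_weight /lagrange_term !nodal_cons subr0 !hornerM hornerX; ring.
transitivity (a * b * (\sum_(i < k.+1) up_weight mu k i)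
  + (a - b) * (\sum_(i < k.+1) outer_c1 mu i * up_weight mu k i)
  - \sum_(i < k.+1) outer_c1 mu i ^+ 2 * up_weight mu k i).
  rewrite !mulr_sumr -big_split -sumrB; apply: eq_bigr => i _ /=; ring.
by rewrite m0 m1 m2; ring.
Qed.

Lemma up_weight_eq0 mu k j : (j < k)%N -> nth 0%N mu j = nth 0%N mu j.+1 ->
  up_weight mu k j.+1 = 0.
Proof.
move=> ltjk eqm; rewrite /up_weight /lagrange_term.
have -> : outer_c1 mu j.+1 =
  inner_c1 mu j by rewrite /inner_c1 /outer_c1 /inner_wt /outer_wt eqm.
suff /rootP-> : root (nodal (inner_pts mu k)) (inner_c1 mu j) by rewrite mul0r.
by rewrite root_prod_XsubC map_f // mem_iota.
Qed.

Lemma down_weight_eq0 mu k j : (j < k)%N -> nth 0%N mu j = nth 0%N mu j.+1 ->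
  down_weight mu k j = 0.
Proof.
move=> ltjk eqm; rewrite /down_weight /lagrange_term.
have -> : inner_c1 mu j =
  outer_c1 mu j.+1 by rewrite /inner_c1 /outer_c1 /inner_wt /outer_wt eqm.
suff /rootP-> :
  root (nodal (outer_pts mu k)) (outer_c1 mu j.+1) by rewrite mul0r.
by rewrite root_prod_XsubC map_f // mem_iota.
Qed.

(** * Adding one box *)

(** The contribution of a fixed point, with the multiplicative form of the
    Euler class. *)
Definition fixed_term mu := chern l1 l2 w (Ltaut mu) / euler_moving (Tvir mu).

Section Growth.
Variables (mu : seq nat) (k i : nat).
Hypotheses (szmu : size mu = k) (ltik : (i < k)%N).
Hypotheses (smu : sorted geq mu) (add : sorted geq (incr_nth mu i)).
Let X := outer_c1 mu i.

(** Adding a box in row [i] moves only the corners of that row: [x_i] by [l1]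
    and [y_i] from [X + l2] to [X + L], where the residue is taken. *)
Lemma down_weight_growth :
  down_weight (incr_nth mu i) k i * \prod_(j < k) (X + L - inner_c1 mu j) =
  l1 * l2 * \prod_(j < k.+1 | val j != i) (X + L - outer_c1 mu j).
Proof.
have inc j : inner_c1 (incr_nth mu i) j =
  inner_c1 mu j + (if i == j then l1 else 0).
  rewrite !inner_c1E !outer_c1E nth_incr_nth; case: eqP => _ /=.
    by rewrite mulrnDr; ring.
  by rewrite add0n; ring.
have out j : outer_c1 (incr_nth mu i) j =
  outer_c1 mu j + (if i == j then l1 else 0).
  by apply: (addIr l2); rewrite -inner_c1E inc inner_c1E addrAC.
have iX : inner_c1 mu i = X + l2 by rewrite inner_c1E.
have D0 : \prod_(j < k | val j != i) (X + L - inner_c1 mu j) != 0.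
  apply/prodf_neq0 => j neji; have <- : inner_c1 (incr_nth mu i) i = X + L.
    by rewrite inc eqxx iX; ring.
  have -> : inner_c1 mu j = inner_c1 (incr_nth mu i) j.
    by rewrite inc eq_sym (negbTE neji) addr0.
  by rewrite subr_eq0 (inj_eq (@inner_c1_inj _)) eq_sym.
rewrite /down_weight /lagrange_term horner_nodal inc eqxx iX.
have -> : X + l2 + l1 = X + L by ring.
rewrite (prod_ordD1 (fun j => X + L - outer_c1 (incr_nth mu i) j)
                    (ltnW ltik : i < k.+1)%N) out eqxx.
rewrite [in LHS](prod_ordD1 (fun j => X + L - inner_c1 mu j) ltik) iX.
rewrite (eq_bigr (fun j : 'I_k.+1 => X + L - outer_c1 mu j)) => /= [|j neji];
  last by rewrite out eq_sym (negbTE neji) addr0.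
rewrite [in LHS](eq_bigr (fun j : 'I_k => X + L - inner_c1 mu j)) =>
  /= [|j neji];
  last by rewrite inc eq_sym (negbTE neji) addr0.
rewrite -/X; field.
exact: D0.
Qed.

Let x := outer_wt mu i.

(** The zero weight is written out: it cancels the term [j = i] of the first
    sum. *)
Lemma growth_charE : Tvir (incr_nth mu i) - Tvir mu =
  \sum_(j < k.+1) << outer_wt mu j - x >> - \sum_(j < k) << inner_wt mu j - x >>
  + (\sum_(j < k.+1) << x + diag_wt - outer_wt mu j >>
     - \sum_(j < k) << x + diag_wt - inner_wt mu j >>)
  - << x + diag_wt >> - (<< 0 >> - t1 - t2 + << diag_wt >>).
Proof.
rewrite Tvir_incr ?szmu // /corner_char szmu.
have dualsum n (f : nat -> weight) :
    vdual (\sum_(j < n) << f j >>) = \sum_(j < n) << - f j >>.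
  by rewrite raddf_sum; apply: eq_bigr => j _; rewrite /= vdualU.
rewrite [vdual (_ - _)]raddfB /= !dualsum.
congr (_ + _ - _ - _).
- rewrite mulrBr !mulr_sumr; congr (_ - _).
    by apply: eq_bigr => j _; rewrite freegU_mul addrC.
  by apply: eq_bigr => j _; rewrite freegU_mul addrC.
- rewrite mulrBr !mulr_sumr; congr (_ - _).
    by apply: eq_bigr => j _; rewrite freegU_mul.
  by apply: eq_bigr => j _; rewrite freegU_mul.
have -> : << diag_wt >> = t1 * t2 :> vchar by rewrite freegU_mul.
rewrite -[<< 0 >>]/(1 : vchar) /koszul; ring.
Qed.

Lemma outer_wt_inj j : outer_wt mu j = x -> j = i. Proof. by case. Qed.

Lemma inner_neq_x j : inner_wt mu j != x.
Proof.
apply/eqP => -[ej jS]; have := addable_neq add jS.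
by rewrite ej eqxx.
Qed.

Lemma outer_neq_xc j : outer_wt mu j != x + diag_wt.
Proof.
apply/eqP => -[ej jS]; have := sorted_geqP _ smu i.
have -> : i.+1 = j by lia.
lia.
Qed.

Lemma inner_neq_xc j : inner_wt mu j != x + diag_wt.
Proof.
apply/eqP => -[ej jS]; have eji : j = i by lia.
by move: ej; rewrite eji; lia.
Qed.

Lemma xc_neq0 : x + diag_wt != 0.
Proof. by apply/eqP => -[]; lia. Qed.

(** Among the weights of [growth_charE] only two vanish, the term [j = i] of
    the first sum and the constant one, and they have opposite signs. All
    others are excluded by [mu] being a partition to which a box is added in
    row [i]. *)
Lemma coeff0_growth : coeff 0 (Tvir (incr_nth mu i)) = coeff 0 (Tvir mu).
Proof.
apply/eqP; rewrite -subr_eq0 -coeffB growth_charE.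
rewrite /t1 /t2 /mon !(coeffB, coeffD, coeffN) !coeff_sumU !coeffU.
rewrite (negbTE xc_neq0) eqxx.
rewrite (eq_count (a2 := pred1 (Ordinal (ltnW ltik : i < k.+1)%N)))
  => [|j]; last by rewrite /= subr_eq0 -val_eqE;
    apply/eqP/eqP => [/outer_wt_inj|/= ->].
rewrite count_uniq_mem ?index_enum_uniq // mem_index_enum.
have none n (f : nat -> weight) : (forall j, f j != 0) ->
    count (fun j : 'I_n => f j == 0) (index_enum 'I_n) = 0%N.
  move=> f0; rewrite (eq_count (a2 := pred0)) ?count_pred0 // => j.
  exact/negbTE.
rewrite (none k (fun j => inner_wt mu j - x)) => [|j]; last first.
  by rewrite subr_eq0 inner_neq_x.
rewrite (none _ (fun j => x + diag_wt - outer_wt mu j)) => [|j]; last first.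
  by rewrite subr_eq0 eq_sym outer_neq_xc.
rewrite (none _ (fun j => x + diag_wt - inner_wt mu j)) => [|j]; last first.
  by rewrite subr_eq0 eq_sym inner_neq_xc.
by [].
Qed.

(** The Euler class of [growth_charE], with denominators cleared. The factor of
    index [i] in the second product over outer corners is [L], which cancels
    the Euler class of the weight [t1 t2]. *)
Lemma euler_growth :
  euler_moving (Tvir (incr_nth mu i)) * (X + L)
    * (\prod_(j < k) (X - inner_c1 mu j)
       * \prod_(j < k) (X + L - inner_c1 mu j)) =
  euler_moving (Tvir mu) * (l1 * l2)
    * (\prod_(j < k.+1 | val j != i) (X - outer_c1 mu j)
       * \prod_(j < k.+1 | val j != i) (X + L - outer_c1 mu j)).
Proof.
have prodB n (f : nat -> weight) y : (forall j, f j != y) ->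
    euler_moving (\sum_(j < n) << y - f j >>) = \prod_(j < n) (c1 y - c1 (f j)).
  move=> fy; rewrite euler_moving_sum; apply: eq_bigr => j _.
  by rewrite movingE ?c1B // subr_eq0 eq_sym.
have prodB' n (f : nat -> weight) y : (forall j, f j != y) ->
    euler_moving (\sum_(j < n) << f j - y >>) = \prod_(j < n) (c1 (f j) - c1 y).
  move=> fy; rewrite euler_moving_sum; apply: eq_bigr => j _.
  by rewrite movingE ?c1B // subr_eq0.
have c1_diag : c1 diag_wt = L by rewrite /c1w /=; ring.
have c1xc : c1 (x + diag_wt) = X + L by rewrite c1D c1_diag.
pose A := \prod_(j < k) (inner_c1 mu j - X).
pose B := \prod_(j < k.+1 | val j != i) (outer_c1 mu j - X).
pose C := \prod_(j < k) (X + L - inner_c1 mu j).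
pose E := \prod_(j < k.+1 | val j != i) (X + L - outer_c1 mu j).
have L0 : L != 0 by rewrite -c1_diag; apply/eqP => /c1_inj0.
have XL0 : X + L != 0 by rewrite -c1xc; apply: contra_neq xc_neq0 => /c1_inj0.
have A0 : A != 0.
  apply/prodf_neq0 => j _; rewrite subr_eq0.
  by apply: contra_neq (inner_neq_x j) => /c1_inj.
have C0 : C != 0.
  apply/prodf_neq0 => j _; rewrite -c1xc subr_eq0 eq_sym.
  by apply: contra_neq (inner_neq_xc j) => /c1_inj.
(* Both products over the corners seen from [X] have [k] factors, so that the
   signs cancel. *)
have -> : \prod_(j < k) (X - inner_c1 mu j) = (-1) ^+ k * A.
  rewrite -[X in (-1) ^+ X]card_ord -prodrN.
  by apply: eq_bigr => j _; rewrite opprB.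
have -> : \prod_(j < k.+1 | val j != i) (X - outer_c1 mu j) = (-1) ^+ k * B.
  have cardk : #|[pred j : 'I_k.+1 | val j != i]| = k.
    rewrite -[RHS]/(k.+1.-1) -[in RHS](card_ord k.+1).
    rewrite -(cardC1 (Ordinal (ltnW ltik : i < k.+1)%N)).
    by apply: eq_card => j.
  rewrite -[X in (-1) ^+ X]cardk -prodrN.
  by apply: eq_bigr => j _; rewrite opprB.
rewrite -/C -/E.
have -> : euler_moving (Tvir (incr_nth mu i)) =
    euler_moving (Tvir mu) * (B / A * (E * L / C) / (X + L) / (L / (l1 * l2))).
  rewrite -[Tvir (incr_nth mu i)](subrK (Tvir mu)) addrC.
  rewrite euler_movingD growth_charE.
  congr (_ * _); rewrite !(euler_movingD, euler_movingN) !euler_movingU.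
  congr (_ / _ * (_ / _) / _ / _).
  - rewrite euler_moving_sum.
    rewrite (prod_ordD1 (fun j => moving (outer_wt mu j - x))
                        (ltnW ltik : i < k.+1)%N).
    rewrite subrr {1}/moving eqxx mul1r; apply: eq_bigr => j neji.
    rewrite movingE ?c1B // subr_eq0.
    by apply: contra_neq neji => /outer_wt_inj.
  - exact/prodB'/inner_neq_x.
  - rewrite prodB; last exact: outer_neq_xc.
    rewrite c1xc mulrC.
    rewrite (prod_ordD1 (fun j => X + L - outer_c1 mu j)
                        (ltnW ltik : i < k.+1)%N).
    by congr (_ * _); rewrite -/X; ring.
  - by rewrite prodB ?c1xc //; exact: inner_neq_xc.
  - by rewrite movingE ?c1xc // xc_neq0.
  rewrite {1}/moving eqxx !movingE // c1_diag c1_t1 c1_t2; field.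
  by rewrite l1_neq0 l2_neq0.
field.
by rewrite A0 C0 L0 XL0 l1_neq0 l2_neq0.
Qed.

(** The residues on the two sides are products over the corners of [mu], and
    their quotient is, up to [L + X], the ratio of the Euler classes of the
    virtual tangent spaces. The factor [1 + w - X] is the Chern class of the
    new box in the tautological bundle, and [L + X] that of the new box in the
    obstruction bundle. *)
Lemma growth_term :
  fixed_term (incr_nth mu i) * down_weight (incr_nth mu i) k i =
  fixed_term mu * ((1 + w - X) * (L + X) * up_weight mu k i).
Proof.
have B0 : \prod_(j < k.+1 | val j != i) (X - outer_c1 mu j) != 0.
  apply/prodf_neq0 => j neji; rewrite subr_eq0 eq_sym.
  by apply: contra_neq neji => /outer_c1_inj.
have C0 : \prod_(j < k) (X + L - inner_c1 mu j) != 0.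
  apply/prodf_neq0 => j _; rewrite subr_eq0 eq_sym.
  apply: contra_neq (inner_neq_xc j) => eqc; apply: c1_inj.
  by rewrite c1D [c1 diag_wt]/c1w /= -/(inner_c1 _ _) eqc mulr0z !mulr1z addr0.
rewrite /fixed_term.
have -> : Ltaut (incr_nth mu i) = Ltaut mu + << (0, 0, 1) - x >>.
  by rewrite /Ltaut !vmulE Qchar_incr ?szmu // mulrDr freegU_mul.
rewrite chernD chernU c1B [c1 (0, 0, 1)]/c1w /= !mulr0z !add0r mulr1z.
have e0 := euler_moving_neq0 (Tvir mu).
have e0' := euler_moving_neq0 (Tvir (incr_nth mu i)).
have := euler_growth; have := down_weight_growth.
rewrite /up_weight /lagrange_term horner_nodal -/X -/(outer_c1 mu i) -/X.
move: (euler_moving (Tvir mu)) (euler_moving (Tvir (incr_nth mu i))) 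
  (down_weight _ _ _) (chern _ _ _ _) e0 e0' B0 C0.
set a := \prod_(j < k) (X - _); set B := \prod_(j < _ | _) (X - _).
set C := \prod_(j < k) _; set E := \prod_(j < _ | _) _.
move=> e e' d c e0 e0' B0 C0 dC eC.
have key : d * e * B = e' * (L + X) * a.
  apply: (mulIf C0); transitivity (e * B * (d * C)); first by ring.
  rewrite dC; transitivity (e * (l1 * l2) * (B * E)); first by ring.
  rewrite -eC; ring.
apply: (mulIf e0'); apply: (mulIf e0); apply: (mulIf B0).
transitivity (c * (1 + w - X) * (d * e * B)); first by field.
rewrite key; field.
by rewrite e0 B0.
Qed.

End Growth.

(** * The recursion in the number of boxes *)

Lemma natrS_neq0 n : n.+1%:R != 0 :> K.
Proof.
apply/eqP => n0; have : c1 (n.+1%:Z, 0, 0) = 0.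
  by rewrite /c1w /= !mulr0z !addr0 -pmulrn -mulr_natr n0 mulr0.
by move/c1_inj0.
Qed.

Lemma Tvir_empty mu : sumn mu = 0%N -> Tvir mu = 0.
Proof.
move=> sum0; suff Q0 : Qchar mu = 0.
  by rewrite /Tvir Q0 !vmulE !mulr0 subrr.
apply: (can_inj vdualK); rewrite vdual_Qchar raddf0; apply: big1 => i _.
have := sum0; rewrite (@sumn_nth (size mu)) // => /eqP.
by rewrite sum_nat_eq0 => /forallP/(_ i)/eqP->; rewrite big_ord0 mulr0.
Qed.

(** The virtual tangent space has no fixed part: it starts from [0], and by
    [coeff0_growth] adding boxes one at a time never creates one. *)
Lemma coeff0_Tvir mu : sorted geq mu -> coeff 0 (Tvir mu) = 0.
Proof.
move: {2}(sumn mu) (erefl (sumn mu)) => n.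
elim: n mu => [|n IHn] mu summu smu; first by rewrite Tvir_empty // coeff0.
have [|j rem] := @exists_removable mu; first by rewrite summu.
have ltj := removable_ltn_size rem.
rewrite -(decr_nthK rem) (@coeff0_growth _ (size mu)) ?decr_nthK //; last first.
- exact: sorted_decr_nth.
- exact: size_decr_nth.
apply: IHn; last exact: sorted_decr_nth.
by apply: succn_inj; rewrite -summu -{2}(decr_nthK rem) sumn_incr_nth.
Qed.

Lemma fixed_termE mu : sorted geq mu ->
  chern l1 l2 w (Ltaut mu) / euler l1 l2 w (Tvir mu) = fixed_term mu.
Proof. by move=> smu; rewrite euler_movingE ?coeff0_Tvir. Qed.

Definition hilb_sum k n : K := \sum_(mu <- partitions k n) fixed_term mu.

Lemma chern_seriesE n : chern_series l1 l2 w n = hilb_sum n n.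
Proof.
rewrite /hilb_sum big_filter big_map big_enum_cond.
apply: eq_big => [mu|mu /andP[smu _]]; first by [].
by rewrite fixed_termE.
Qed.

(** Weight each edge of Young's graph by [fixed_term nu * down_weight nu].
    Summed from above, the weights of the edges below [nu] add up by
    [down_sum]; summed from below, [growth_term] and [up_moments] evaluate the
    edges above [mu]. *)
Lemma hilb_sum_rec k n : (n < k)%N ->
  l1 * l2 *+ n.+1 * hilb_sum k n.+1 =
    ((1 + w) * L + l1 * l2 *+ n) * hilb_sum k n.
Proof.
move=> ltnk; rewrite /hilb_sum !mulr_sumr.
transitivity (\sum_(p <- growths k n) fixed_term p.1 * down_weight p.1 k p.2).
  rewrite -(perm_big _ (perm_growths k n)) big_allpairs_dep /=.
  rewrite big_seq [RHS]big_seq.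
  apply: eq_bigr => nu;
    rewrite mem_partitions => /and3P[/eqP sznu snu /eqP sumnu].
  rewrite -mulr_sumr -sumnu -(down_sum sznu (natrS_neq0 1)) mulrC;
    congr (_ * _).
  rewrite big_filter [in RHS]big_mkcond -(big_mkord xpredT (down_weight nu k)).
  rewrite /index_iota subn0 !big_seq; apply: eq_bigr => j.
  rewrite mem_iota add0n => ltjk; case: ltnP => // le.
  apply: down_weight_eq0 => //; apply/eqP.
  by rewrite eqn_leq le; apply: (sorted_geqP _ snu).
rewrite /growths big_allpairs_dep /= big_seq [RHS]big_seq.
apply: eq_bigr => mu;
  rewrite mem_partitions => /and3P[/eqP szmu smu /eqP summu].
rewrite -summu -(up_moments (1 + w) L szmu (natrS_neq0 1)) mulrC mulr_sumr.
rewrite big_filter big_mkcond big_ord_recr /=.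
(* The last outer corner would be a box in row [k], but the row before it is
   empty as well. *)
have -> : up_weight mu k k = 0.
  case: k ltnk szmu => // k ltnk szmu; apply: up_weight_eq0 => //.
  rewrite [RHS]nth_default ?szmu //.
  by rewrite -[k]/(k.+1.-1) (@nth_sorted_eq0 _ k.+1) ?summu.
rewrite !mulr0 addr0.
pose F i := (1 + w - outer_c1 mu i) * (L + outer_c1 mu i) * up_weight mu k i.
rewrite -(big_mkord xpredT (fun i => fixed_term mu * F i)).
rewrite /index_iota subn0 !big_seq; apply: eq_bigr => i.
rewrite mem_iota add0n => ltik; case: ifP => [add|/negbT nadd].
  exact: growth_term.
have [j ij eqm] := not_addable smu nadd; subst i.
by rewrite /F up_weight_eq0 ?mulr0 // ltnW.
Qed.

Lemma hilb_sum_stable k n : (n <= k)%N -> hilb_sum k.+1 n = hilb_sum k n.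
Proof.
move=> lenk; rewrite /hilb_sum (perm_big _ (perm_partitions_rcons lenk)).
rewrite big_map !big_seq; apply: eq_bigr => mu;
  rewrite mem_partitions => /and3P[/eqP szmu _ _].
have dQ : Qchar (rcons mu 0%N) = Qchar mu.
  apply: (can_inj vdualK); rewrite !vdual_Qchar size_rcons big_ord_recr /=.
  rewrite nth_rcons ltnn eqxx big_ord0 mulr0 addr0.
  by apply: eq_bigr => i _; rewrite nth_rcons ltn_ord.
by rewrite /fixed_term /Tvir /Ltaut dQ.
Qed.

Lemma hilb_sum00 : hilb_sum 0 0 = 1.
Proof.
have -> : hilb_sum 0 0 = \sum_(mu <- [:: [::]]) fixed_term mu.
  apply: perm_big; apply: uniq_perm; rewrite ?uniq_partitions // => mu.
  by rewrite mem_partitions inE; case: mu.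
rewrite big_seq1 /fixed_term Tvir_empty // euler_moving0 divr1.
rewrite /Ltaut /Qchar big_nil vmulE mulr0.
by rewrite /chern dom0 big_nil.
Qed.

Lemma chern_series_rec :
  binomial_rec (- ((1 + w) * L / (l1 * l2))) (chern_series l1 l2 w).
Proof.
split=> [|n]; first by rewrite chern_seriesE hilb_sum00.
rewrite !chern_seriesE.
have := hilb_sum_rec (ltnSn n); rewrite (hilb_sum_stable (leqnn n)).
rewrite -[l1 * l2 *+ n.+1]mulr_natr -[_ *+ n]mulr_natr => E.
apply: (mulfI (mulf_neq0 l1_neq0 l2_neq0)); rewrite mulrA E.
by field; rewrite l1_neq0 l2_neq0.
Qed.

End Localization.

(** * Genericity of the equivariant parameters *)

Section Generic.
Variable R : realType.
Local Notation c1 := (c1w (lambda1 R) (lambda2 R) (w1 R)).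

Definition c1_poly (x : weight) : {mpoly (complex R)[3]} :=
  'X_(inord 0) *~ x.1.1 + 'X_(inord 1) *~ x.1.2 + 'X_(inord 2) *~ x.2.

Lemma c1_polyE x : c1 x = tofrac (c1_poly x).
Proof. by rewrite /c1_poly !raddfD /= !raddfMz. Qed.

(** The Chern class of a weight is a linear form with the integral coordinates
    of the weight as coefficients, in characteristic zero. *)
Lemma c1_generic x : c1 x = 0 -> x = 0.
Proof.
move/eqP; rewrite c1_polyE tofrac_eq0 => /eqP p0.
have coef i : (i < 3)%N ->
    (i == 0%N)%:R *~ x.1.1 + (i == 1%N)%:R *~ x.1.2 + (i == 2%N)%:R *~ x.2 = 0
    :> complex R.
  move=> lti; have : (c1_poly x)@_U_(inord i) = 0 by rewrite p0 mcoeff0.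
  rewrite /c1_poly !mcoeffD !raddfMz /= !mcoeffXU -!val_eqE /= !inordK //.
  by rewrite ![_ == i]eq_sym.
have := coef 0%N isT; have := coef 1%N isT; have := coef 2%N isT.
rewrite /= !mul0rz ?addr0 ?add0r => /eqP; rewrite intr_eq0 => /eqP c0 /eqP.
rewrite intr_eq0 => /eqP b0 /eqP; rewrite intr_eq0 => /eqP a0.
by move: x a0 b0 c0 {p0 coef} => [[a b] c] /= -> -> ->.
Qed.

Lemma c1D1_generic x : 1 + c1 x != 0.
Proof.
rewrite c1_polyE -tofrac1 -tofracD tofrac_eq0.
apply/eqP => /(congr1 (mcoeff 0%MM)) /eqP.
rewrite /c1_poly !mcoeffD !raddfMz /= mcoeff1 eqxx !mcoeffX !mnm1_eq0 mcoeff0.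
by rewrite !mul0rz !addr0 oner_eq0.
Qed.
End Generic.

Theorem corollary1p4 (R : realType) :
  chern_series (lambda1 R) (lambda2 R) (w1 R) =1
    fps_powr (fps_sub (fps_one (eqfield R)) (fps_X (eqfield R)))
      (- integralS (lambda1 R) (lambda2 R)
           (chern (lambda1 R) (lambda2 R) (w1 R) v1 *
            chern1 (lambda1 R) (lambda2 R) (w1 R) tangentS)).
Proof.
have natr0 := natrS_neq0 (@c1_generic R).
rewrite chern_v1 chern1_tangentS.
apply: (binomial_rec_uniq natr0); last exact: fps_powr_1subX.
exact: chern_series_rec (@c1_generic R) (@c1D1_generic R).
Qed.
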